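(* Let $g:\mathbb{N}\to\mathbb{R}$ be a function such that $g(n)\to\infty$ as $n\to\infty$. Then for all sufficiently large $n$ there is an (explicitly describable) subset $B_n\subseteq A_n$ such that all points of $A_n$, except at most $100\,|E_n(g)|^2$ of them, are visible from $B_n$, and $$|B_n|\le 800\, g(n)\log\log g(n).$$
   Context: For $n\in\mathbb{N}$, $A_n=\{(x,y)\in\mathbb{Z}^2: 1\le x\le n,\ 1\le y\le n\}$ is the set of lattice points of the $n\times n$ grid. Two distinct lattice points $P,Q\in\mathbb{Z}^2$ are visible from each other if the line segment joining them contains no lattice point strictly between them, equivalently if the differences of their coordinates are coprime. A lattice point is visible from a set $B$ of lattice points if it is visible from some point of $B$. $\omega(m)$ denotes the number of distinct prime factors of $m$, and $E_n(g)=\{m\in\mathbb{N}: m\le n,\ \omega(m)\ge g(n)\}$, where $\mathbb{N}$ is the set of positive integers. *)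

(* Defs.v *)
From HB Require Import structures.
From mathcomp Require Import all_boot all_order all_algebra finmap zify ring.
From mathcomp Require Import all_classical all_reals all_analysis.

Set Implicit Arguments.
Unset Strict Implicit.
Unset Printing Implicit Defensive.

Import Order.TTheory GRing.Theory Num.Theory.
Import numFieldNormedType.Exports.

Local Open Scope ring_scope.

Notation lattice_point := (int * int)%type.

Definition grid (n : nat) : {fset lattice_point} :=
  [fset (x%:Z, y%:Z) | x in iota 1 n, y in iota 1 n]%fset.

Lemma in_grid (n : nat) (P : lattice_point) :
  (P \in grid n) = (1 <= P.1 <= n%:Z) && (1 <= P.2 <= n%:Z).
Proof.
apply/imfset2P/idP => [[x + [y + ->]]|] /=.
  by rewrite !mem_iota !add1n !ltnS !lez_nat => -> ->.
case: P => [[x|x] [y|y]] /=; rewrite ?andbF //= !lez_nat => /andP[xn yn].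
by exists x; [rewrite /= mem_iota add1n ltnS|
   exists y; [rewrite /= mem_iota add1n ltnS|]].
Qed.

Definition strictly_between (R : realType) (P Q Z : lattice_point) : Prop :=
  exists2 t : R, 0 < t < 1 &
    Z.1%:~R = (1 - t) * P.1%:~R + t * Q.1%:~R /\
    Z.2%:~R = (1 - t) * P.2%:~R + t * Q.2%:~R.

(* A point is not visible from itself, so a point of B counts as visible from B
   only if another point of B sees it. *)
Definition visible (R : realType) (P Q : lattice_point) : Prop :=
  P <> Q /\ forall Z : lattice_point, ~ strictly_between R P Q Z.

Lemma visibleP (R : realType) (P Q : lattice_point) :
  visible R P Q <-> coprimez (Q.1 - P.1) (Q.2 - P.2).
Proof.
case: P Q => [p1 p2] [q1 q2]; rewrite /visible /strictly_between /=.
split=> [[PQ noZ]|cop].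
  set a := q1 - p1; set b := q2 - p2.
  have [u ua] : exists u, a = u * gcdz a b.
    by exists (a %/ gcdz a b)%Z; rewrite divzK // dvdz_gcdl.
  have [v vb] : exists v, b = v * gcdz a b.
    by exists (b %/ gcdz a b)%Z; rewrite divzK // dvdz_gcdr.
  rewrite /coprimez; apply/eqP; move: ua vb.
  have : 0 <= gcdz a b by [].
  move: (gcdz a b) => [[|[|d]]|d] // _ ua vb.
    exfalso; apply: PQ; move: ua vb; rewrite !mulr0 => /eqP + /eqP.
    by rewrite !subr_eq0 => /eqP -> /eqP ->.
  exfalso; apply: (noZ (p1 + u, p2 + v)).
  have d0 : (d.+2%:R : R) != 0 by rewrite pnatr_eq0.
  exists (d.+2%:R^-1).
    by rewrite invr_gt0 ltr0n /= invf_lt1 ?ltr0n // ltr1n.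
  have aux (p q w : int) : q - p = w * d.+2%:Z ->
      (p + w)%:~R = (1 - d.+2%:R^-1) * p%:~R + d.+2%:R^-1 * q%:~R :> R.
    move=> /eqP; rewrite subr_eq => /eqP ->.
    rewrite !rmorphD /= rmorphM /= mulrDr mulrBl mul1r.
    rewrite (_ : (d.+2%:Z)%:~R = d.+2%:R :> R) // mulrCA mulVf // mulr1.
    by rewrite addrA addrAC subrK.
  by split; apply: aux.
split.
  by case=> p1q p2q; move: cop; rewrite p1q p2q !subrr.
move=> [z1 z2] [t /andP[t0 t1] /= [e1 e2]].
move: cop => /coprimezP[[s r] /= sr].
have aux (p q z : int) : z%:~R = (1 - t) * p%:~R + t * q%:~R :> R ->
    (z - p)%:~R = t * (q - p)%:~R :> R.
  by move=> e; rewrite !rmorphB /= e; ring.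
have tE : t = (s * (z1 - p1) + r * (z2 - p2))%:~R.
  rewrite rmorphD !rmorphM /= (aux _ _ _ e1) (aux _ _ _ e2).
  by rewrite mulrCA [X in _ + X]mulrCA -mulrDr -!rmorphM -rmorphD /= sr mulr1.
move: t0 t1; rewrite tE ltr0z ltrz1; lia.
Qed.

Definition visible_from (R : realType) (B : {fset lattice_point})
    (P : lattice_point) : Prop :=
  exists2 Q : lattice_point, Q \in B & visible R P Q.

Definition invisible (R : realType) (n : nat) (B : {fset lattice_point}) :
    {fset lattice_point} :=
  [fset P in grid n | ~~ `[< visible_from R B P >]]%fset.

Definition omega (m : nat) : nat := size (primes m).

Definition E_set (R : realType) (g : nat -> R) (n : nat) : {fset nat} :=
  [fset m in iota 1 n | g n <= (omega m)%:R]%fset.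

(* Main.v *)
Require Import Defs.
From HB Require Import structures.
From mathcomp Require Import all_boot all_order all_algebra finmap zify ring lra.
From mathcomp Require Import all_classical all_reals all_analysis.

(** A point [(a, b)] sees [(x, y)] when [a - x] and [b - y] are coprime.  The
set [B] consists of the [h] by [J] rectangle of points [(a, b)] at the corner
of the grid and of its transpose, with [J] of order [g n] and [h] of order
[log (log (g n))].

Fix [x] and suppose that some column [a <= h] is such that [d = a - x] has at
most [K] prime factors, [K] being about [g n], and that the reciprocals of
these primes sum to at most [13 / 16].  Each prime [p] dividing [d] also divides
at most [J / p + 1] of the numbers [b - y], so [J = 6 K] values of [b] suffice
for one of them to be coprime to [d] ([exists_coprime_dist]), and then [(a, b)]
sees [(x, y)] for every [y].  The prime factors of [d] above [z >= 16 K]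
contribute at most [K / z <= 1 / 16] to the sum of reciprocals, so only those
up to [z] matter.

For the primes up to [z], average over the columns: a prime [p] divides at most
[h / p + 1] of the [a - x], so the mean over [a <= h] of the sum of [1 / p] over
the [p <= z] dividing [a - x] is at most the sum of the [1 / p ^ 2], which is at
most [1 / 2], plus [M / h], where [M] is the sum of [1 / p] over all primes
[p <= z].  A bound on binomial coefficients in the manner of Chebyshev gives
[M <= 2 log (log z) + O(1)] ([prime_recip_pow2_ln]), so [h] of order
[log (log (g n))] makes [M / h <= 1 / 16] and leaves at least a quarter of the
columns with sum at most [3 / 4] ([count_prime_recip_dist_gt]).

Hence [(x, y)] can be missed by the rectangle only if [|a - x|] lies in [E_n]
for at least [h / 5] columns [a]; as every [a] and every element of [E_n]
account for at most two [x], there are at most [10 |E_n|] such exceptional [x]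
([count_exceptional]).  The transposed rectangle gives the same for [y], so the
points missed by [B] form a subset of a product of two sets of size at most
[10 |E_n|].

If [g n] exceeds [log n], the rectangle might not fit in the grid; but a number
up to [n] has at most [log_2 n] prime factors in any case, so [K] is taken to
be the minimum of the two bounds. *)

Set Implicit Arguments.
Unset Strict Implicit.
Unset Printing Implicit Defensive.

Import Order.TTheory GRing.Theory Num.Theory.
Import numFieldNormedType.Exports.

Local Open Scope classical_set_scope.
Local Open Scope ring_scope.

(** * Coprime values in an interval *)

Lemma dvdn_dist_mod (p a x : nat) :
  (p %| `|a%:Z - x%:Z|)%N = (a == x %[mod p])%N.
Proof.
have := eqz_mod_dvd p a x.
by rewrite dvdzE !modz_nat eqz_nat => ->.
Qed.

(** A residue class modulo [p] meets each block [qp <= a < qp + p] once, so the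
quotients by [p] are distinct, and they are at most [J %/ p]. *)
Lemma count_dvd_dist_le (p x J : nat) : (0 < p)%N ->
  (count (fun a => p %| `|a%:Z - x%:Z|)%N (iota 1 J) <= (J %/ p).+1)%N.
Proof.
move=> p0; rewrite -size_filter -(size_map (divn^~ p)).
rewrite -[leqRHS](size_iota 0); apply: uniq_leq_size => [|_ /mapP[a + ->]].
  rewrite map_inj_in_uniq ?filter_uniq ?iota_uniq // => a b.
  rewrite !mem_filter !dvdn_dist_mod => /andP[/eqP ax _] /andP[/eqP bx _] ab.
  by rewrite (divn_eq a p) (divn_eq b p) ax bx /= ab.
rewrite mem_filter !mem_iota add1n !ltnS => /and3P[_ _ aJ] /=.
exact: leq_div2r.
Qed.

Lemma count_dvd_dist_ler (R : realType) (p x J : nat) : (0 < p)%N ->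
  (count (fun a => p %| `|a%:Z - x%:Z|)%N (iota 1 J))%:R <= J%:R / p%:R + 1 :> R.
Proof.
move=> p0.
apply: (@le_trans _ _ (J %/ p).+1%:R); first by rewrite ler_nat count_dvd_dist_le.
rewrite -natr1 lerD2r ler_pdivlMr ?ltr0n // -natrM ler_nat.
exact: leq_divM.
Qed.

Lemma not_coprime_prime_dvd (d m : nat) : (0 < d)%N -> ~~ coprime d m ->
  exists2 p, p \in primes d & (p %| m)%N.
Proof.
move=> d0 /eqP ndm; have gt1 : (1 < gcdn d m)%N.
  by move: (gcdn_gt0 d m); rewrite d0 /=; lia.
exists (pdiv (gcdn d m)).
  rewrite mem_primes pdiv_prime // d0 /=.
  exact: dvdn_trans (pdiv_dvd _) (dvdn_gcdl _ _).
exact: dvdn_trans (pdiv_dvd _) (dvdn_gcdr _ _).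
Qed.

(** Both the sieve and the averaging below count incidences between points [i]
and primes [p], weighted by [w p], by exchanging the two summations. *)
Lemma sum_count_dvd (R : realType) (I : Type) (s : seq I) (r : seq nat)
    (P : pred nat) (e : I -> nat -> bool) (w : nat -> R) :
  \sum_(i <- s) \sum_(p <- r | P p && e i p) w p =
  \sum_(p <- r | P p) w p * (count (e^~ p) s)%:R.
Proof.
under eq_bigr do rewrite big_mkcondr /=.
rewrite exchange_big /=; apply: eq_bigr => p _.
by rewrite -big_mkcond /= big_const_seq iter_addr_0 mulr_natr.
Qed.

(** The hypothesis is the union bound: if every [a <= J] shared a prime with
[d], then the at most [J / p + 1] multiples among the [a - x] of each prime [p]
dividing [d] would add up to at least [J]. *)
Lemma exists_coprime_dist (R : realType) (d x J : nat) : (0 < d)%N ->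
  J%:R * (\sum_(p <- primes d) p%:R^-1) + (omega d)%:R < J%:R :> R ->
  exists2 a, a \in iota 1 J & coprime d `|a%:Z - x%:Z|.
Proof.
move=> d0; case: (boolP (has (fun a : nat => coprime d `|a%:Z - x%:Z|) (iota 1 J))).
  by move=> /hasP[a aJ cop] _; exists a.
move=> /hasPn no /lt_geF/negP[].
have J_le : J%:R <= \sum_(a <- iota 1 J)
    \sum_(p <- primes d | true && (p %| `|a%:Z - x%:Z|)%N) 1 :> R.
  rewrite -{1}(size_iota 1 J) -sum1_size natr_sum.
  rewrite big_seq [leRHS]big_seq; apply: ler_sum => a /no.
  move=> /(not_coprime_prime_dvd d0)[p pd pa].
  rewrite (big_rem p pd) /= pa lerDl; apply: sumr_ge0 => *; exact: ler01.
apply: le_trans J_le _; rewrite sum_count_dvd.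
apply: (@le_trans _ _ (\sum_(p <- primes d) (J%:R * p%:R^-1 + 1))).
  rewrite big_seq [leRHS]big_seq; apply: ler_sum => p.
  rewrite mem_primes => /andP[/prime_gt0 p0 _].
  by rewrite mul1r count_dvd_dist_ler.
by rewrite big_split /= -mulr_sumr lerD2l big_const_seq iter_addr_0 count_predT.
Qed.

(** * Averaging over the columns *)

Definition prime_recip (R : realType) (z : nat) (P : pred nat) : R :=
  \sum_(0 <= p < z.+1 | prime p && P p) p%:R^-1.

(** Apart from [2], which contributes [1 / 4], primes are odd, and the sum of
[1 / m ^ 2] over odd [m >= 3] is dominated by the sum of
[(1 / (m - 1) - 1 / (m + 1)) / 2], which telescopes to [1 / 4]. *)
Lemma prime_recip_sqr_le (R : realType) (z : nat) :
  \sum_(0 <= p < z.+1 | prime p) (p%:R ^+ 2)^-1 <= 2^-1 :> R.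
Proof.
(* The telescoping remainder: with all primes up to [2 j + 2] counted, the sum
   of the bounds for the remaining odd numbers is [1 / (4 (j + 1))]. *)
have aux j : \sum_(0 <= p < (j.+1).*2.+1 | prime p) (p%:R ^+ 2)^-1
    <= 2^-1 - (4 * j.+1%:R)^-1 :> R.
  elim: j => [|j IH].
    by rewrite unlock /= -natrM; lra.
  rewrite doubleS big_mkcond /= big_nat_recr // big_nat_recr //= -big_mkcond /=.
  have -> : prime j.+1.*2.+2 = false.
    apply/negP => /even_prime[//|]; by rewrite /= odd_double.
  rewrite addr0; apply: le_trans (lerD IH (_ : _ <= (4 * j.+1%:R * j.+2%:R)^-1)) _.
    have j0 : 0 < j.+1%:R :> R by rewrite ltr0n.
    have j1 : 0 < j.+2%:R :> R by rewrite ltr0n.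
    have key : 4 * j.+1%:R * j.+2%:R <= j.+1.*2.+1%:R ^+ 2 :> R.
      rewrite -!natrM -natrX ler_nat; lia.
    case: ifP => _; last by rewrite invr_ge0 !mulr_ge0 // ltW.
    by rewrite lef_pV2 // posrE ?exprn_gt0 ?mulr_gt0 ?ltr0n.
  rewrite le_eqVlt; apply/orP; left; apply/eqP.
  rewrite -(natr1 j.+1) -(natr1 j).
  have : j%:R + 1 != 0 :> R by rewrite natr1 pnatr_eq0.
  have : j%:R + 1 + 1 != 0 :> R by rewrite !natr1 pnatr_eq0.
  by move=> ? ?; field; apply/andP; split.
apply: le_trans (_ : _ <= \sum_(0 <= p < (z.+1).*2.+1 | prime p) (p%:R ^+ 2)^-1) _.
  rewrite [leRHS](@big_cat_nat _ _ _ z.+1) /=; [|lia|lia].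
  by rewrite lerDl; apply: sumr_ge0 => p _; rewrite invr_ge0 exprn_ge0.
apply: le_trans (aux z) _; rewrite gerBl invr_ge0; exact: mulr_ge0.
Qed.

(** The primes [p <= z] hit each at most [h / p + 1] columns with weight
[1 / p]; the first term is summable over [p], so only the sum of the second one
grows with [z], and it is not multiplied by [h]. *)
Lemma prime_recip_dist_average (R : realType) (z h x : nat) :
  \sum_(a <- iota 1 h) prime_recip R z (fun p => p %| `|a%:Z - x%:Z|)%N
    <= h%:R / 2 + prime_recip R z predT.
Proof.
rewrite /prime_recip sum_count_dvd.
apply: (@le_trans _ _ (\sum_(0 <= p < z.+1 | prime p)
   (h%:R * (p%:R ^+ 2)^-1 + p%:R^-1))).
  apply: ler_sum => p pp; rewrite -exprVn.
  have -> : h%:R * p%:R^-1 ^+ 2 + p%:R^-1 = p%:R^-1 * (h%:R / p%:R + 1) :> R.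
    by ring.
  by rewrite ler_wpM2l ?invr_ge0 // count_dvd_dist_ler // prime_gt0.
rewrite big_split /= -mulr_sumr lerD //.
  by rewrite ler_wpM2l // prime_recip_sqr_le.
by rewrite le_eqVlt; apply/orP; left; apply/eqP/eq_bigl => p; rewrite andbT.
Qed.

Lemma prime_recip_ge0 (R : realType) (z : nat) (P : pred nat) :
  0 <= prime_recip R z P.
Proof. by apply: sumr_ge0 => p _; rewrite invr_ge0. Qed.

(** Markov's inequality: the mean is at most [1 / 2 + 1 / 16 = 9 / 16], which is
three quarters of the threshold [3 / 4]. *)
Lemma count_prime_recip_dist_gt (R : realType) (z h x : nat) :
  16 * prime_recip R z predT <= h%:R ->
  (count (fun a : nat => 3 / 4 < prime_recip R z
    (fun p => p %| `|a%:Z - x%:Z|)%N) (iota 1 h))%:R <= 3 / 4 * h%:R :> R.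
Proof.
move=> hM; have := prime_recip_dist_average R z h x.
set C := count _ _.
have : C%:R * (3 / 4) <= \sum_(a <- iota 1 h) prime_recip R z (fun p => p %| `|a%:Z - x%:Z|)%N.
  rewrite mulr_natl -iter_addr_0 -big_const_seq [leLHS]big_mkcond /=.
  by apply: ler_sum => a _; case: ifP => [/ltW//|_]; exact: prime_recip_ge0.
lra.
Qed.

(** * An upper bound of Mertens type for the sum of prime reciprocals *)

Lemma prod_primes_dvdn (s : seq nat) (m : nat) : uniq s ->
  (forall p, p \in s -> prime p /\ (p %| m)%N) -> (\prod_(p <- s) p %| m)%N.
Proof.
elim: s => [|q s IH] /=; first by rewrite big_nil dvd1n.
move=> /andP[qs us] all_s; have [qp qm] := all_s q (mem_head _ _).
have s_all p : p \in s -> prime p /\ (p %| m)%N.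
  by move=> ps; apply: all_s; rewrite inE ps orbT.
rewrite big_cons Gauss_dvd ?qm ?IH // prime_coprime // Euclid_dvd_prod //.
apply/negP; rewrite big_has => /hasP[p ps].
by rewrite dvdn_prime2 ?(s_all p ps).1 // => /eqP qp'; rewrite qp' ps in qs.
Qed.

Lemma bin_le_expn2 (n m : nat) : ('C(n, m) <= 2 ^ n)%N.
Proof.
elim: n m => [|n IH] [|m]; rewrite ?bin0 ?bin0n ?expn_gt0 //.
by rewrite binS expnS mul2n -addnn leq_add.
Qed.

(** Such a prime divides [(2n)!] but neither factor [n!] of the denominator. *)
Lemma prime_dvd_central_bin (n p : nat) : prime p -> (n < p <= n.*2)%N ->
  (p %| 'C(n.*2, n))%N.
Proof.
move=> pp /andP[np pn]; have := dvdn_fact (_ : 0 < p <= n.*2)%N.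
rewrite prime_gt0 // pn => /(_ isT).
rewrite -(@bin_fact n.*2 n); last by rewrite -addnn leq_addr.
rewrite -addnn addnK Euclid_dvdM // => /orP[//|].
rewrite Euclid_dvdM // orbb fact_prod Euclid_dvd_prod // big_has.
move=> /hasP[i]; rewrite mem_index_iota => /andP[i0 i1] /(dvdn_leq i0); lia.
Qed.

Definition dyadic_primes (k : nat) :=
  [seq p <- index_iota (2 ^ k).+1 (2 ^ k.+1).+1 | prime p].

(** Chebyshev's argument with [n = 2 ^ k]: the product of the primes [p] with
[n < p <= 2n] divides the binomial coefficient of [2n] over [n], so it is at most
[2 ^ (2n)], while each of them exceeds [2 ^ k]. *)
Lemma size_dyadic_primes (k : nat) :
  (k * size (dyadic_primes k) <= 2 ^ k.+1)%N.
Proof.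
rewrite -(leq_exp2l _ _ (ltnSn 1)) expnM.
have -> : ((2 ^ k) ^ size (dyadic_primes k) =
    \prod_(p <- dyadic_primes k) 2 ^ k)%N.
  by rewrite big_const_seq count_predT iter_muln_1.
have mem_dyadic p : p \in dyadic_primes k ->
    prime p /\ (2 ^ k < p <= (2 ^ k).*2)%N.
  by rewrite mem_filter mem_index_iota ltnS expnS mul2n => /andP[].
apply: (@leq_trans (\prod_(p <- dyadic_primes k) p)).
  rewrite big_seq [leqRHS]big_seq; apply: leq_prod => p /mem_dyadic[_].
  by move=> /andP[/ltnW].
apply: leq_trans (bin_le_expn2 _ (2 ^ k)).
rewrite dvdn_leq ?bin_gt0 ?leq_exp2l //.
apply: prod_primes_dvdn; first by rewrite filter_uniq ?iota_uniq.
move=> p /mem_dyadic[pp pk]; split=> //.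
by rewrite expnS mul2n; exact: prime_dvd_central_bin.
Qed.

(** The at most [2 ^ (k + 1) / k] primes of the [k]-th dyadic interval, each
with reciprocal at most [2 ^ - k], contribute at most [2 / k]. *)
Lemma prime_recip_pow2_le (R : realType) (l : nat) :
  prime_recip R (2 ^ l.+1) predT <= 2^-1 + 2 * (\sum_(1 <= k < l.+1) k%:R^-1).
Proof.
elim: l => [|l IH].
  by rewrite /prime_recip expn1 unlock /=; lra.
rewrite [in leRHS]big_nat_recr //= mulrDr addrA.
rewrite /prime_recip (@big_cat_nat _ _ _ (2 ^ l.+1).+1) //=; last first.
  by rewrite ltnS leq_exp2l.
apply: lerD IH _.
under eq_bigl do rewrite andbT.
rewrite -big_filter.
apply: (@le_trans _ _ (\sum_(p <- dyadic_primes l.+1) (2 ^ l.+1)%:R^-1)).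
  rewrite big_seq [leRHS]big_seq; apply: ler_sum => p.
  rewrite mem_filter mem_index_iota => /andP[pp /andP[/ltnW lp _]].
  by rewrite lef_pV2 ?posrE ?ltr0n ?expn_gt0 ?prime_gt0 // ler_nat.
rewrite big_const_seq count_predT iter_addr_0 -[_ *+ size _]mulr_natr.
rewrite ler_pdivrMl ?ltr0n ?expn_gt0 // mulrA ler_pdivlMr ?ltr0n //.
by rewrite mulrC -!natrM ler_nat -expnSr size_dyadic_primes.
Qed.

Lemma harmonic_le_ln (R : realType) (l : nat) :
  \sum_(1 <= k < l.+2) k%:R^-1 <= 1 + ln l.+1%:R :> R.
Proof.
elim: l => [|l IH]; first by rewrite big_nat1 ln1 invr1 addr0.
rewrite big_nat_recr //=.
have l1 : 0 < l.+1%:R :> R by rewrite ltr0n.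
have l2 : 0 < l.+2%:R :> R by rewrite ltr0n.
have lr : l.+2%:R = l.+1%:R + 1 :> R by rewrite natr1.
have step : ln (1 + - l.+2%:R^-1) <= - l.+2%:R^-1 :> R.
  by apply: le_ln1Dx; rewrite ltrN2 invf_lt1 // ltr1n.
have e : 1 + - l.+2%:R^-1 = l.+1%:R / l.+2%:R :> R.
  apply: (mulIf (lt0r_neq0 l2)).
  by rewrite mulrDl mul1r mulNr mulVf ?divfK ?lt0r_neq0 // lr addrK.
move: step; rewrite e ln_div ?posrE // lerBlDr => step.
rewrite addrC -lerBrDl; apply: le_trans IH _; rewrite lerBrDl.
by rewrite addrCA lerD2l -lerBrDl addrC.
Qed.

Lemma prime_recip_pow2_ln (R : realType) (l : nat) :
  prime_recip R (2 ^ l.+2) predT <= 5 / 2 + 2 * ln l.+1%:R.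
Proof. by have := prime_recip_pow2_le R l.+1; have := harmonic_le_ln R l; lra. Qed.

(** * Exceptional abscissas *)

Lemma sum_primes_recip_le (R : realType) (d z : nat) : (0 < d)%N -> (0 < z)%N ->
  \sum_(p <- primes d) p%:R^-1 <=
    prime_recip R z (fun p => p %| d)%N + (omega d)%:R / z%:R.
Proof.
move=> d0 z0; rewrite (bigID (fun p => p <= z)%N) /=; apply: lerD.
  rewrite /prime_recip -big_filter -[leRHS]big_filter le_eqVlt; apply/orP; left.
  apply/eqP/perm_big/uniq_perm; rewrite ?filter_uniq ?primes_uniq ?iota_uniq //.
  move=> p; rewrite !mem_filter mem_index_iota mem_primes d0 ltnS /=.
  by rewrite andbC.
rewrite -big_filter.
apply: (@le_trans _ _ (\sum_(p <- [seq p <- primes d | ~~ (p <= z)%N]) z%:R^-1)).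
  rewrite big_seq [leRHS]big_seq; apply: ler_sum => p.
  rewrite mem_filter -ltnNge => /andP[zp _].
  by rewrite lef_pV2 ?posrE ?ltr0n ?(leq_trans z0) // ?ler_nat ltnW.
rewrite big_const_seq count_predT iter_addr_0 -[_ *+ size _]mulr_natl.
by rewrite ler_wpM2r ?invr_ge0 // ler_nat size_filter count_size.
Qed.

(** The constant [6] works because the reciprocals of all primes dividing [d]
sum to at most [3 / 4 + 1 / 16 = 13 / 16], and [6 * (1 - 13 / 16) > 1]. *)
Lemma exists_coprime_dist_of_small_recip (R : realType) (K z d y : nat) :
  (0 < K)%N -> (16 * K <= z)%N -> (0 < d)%N -> (omega d <= K)%N ->
  prime_recip R z (fun p => p %| d)%N <= 3 / 4 ->
  exists2 b, b \in iota 1 (6 * K) & coprime d `|b%:Z - y%:Z|.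
Proof.
move=> K0 Kz d0 dK small; apply: (@exists_coprime_dist R) => //.
have z0 : (0 < z)%N by lia.
have := sum_primes_recip_le R d0 z0; set S := \sum_(_ <- _) _ => S_le.
have omega_z : (omega d)%:R / z%:R <= 16^-1 :> R.
  by rewrite ler_pdivrMr ?ltr0n // ler_pdivlMl // -natrM ler_nat; lia.
have dKr : (omega d)%:R <= K%:R :> R by rewrite ler_nat.
have K0r : 0 < K%:R :> R by rewrite ltr0n.
rewrite natrM.
have S_le' : S <= 13 / 16 by lra.
have : 6 * K%:R * S <= 6 * K%:R * (13 / 16) by rewrite ler_wpM2l // mulr_ge0.
lra.
Qed.

(** [a = x] is excluded because a difference [0] has no bounded number of prime
factors. *)
Definition usable (R : realType) (z x a : nat) : bool :=
  (a != x) && (prime_recip R z (fun p => p %| `|a%:Z - x%:Z|)%N <= 3 / 4).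

(** At least [h / 4] columns have a small sum of reciprocals, and at most one of
them is [x] itself; [h / 4 - 1 >= h / 5] as soon as [h >= 20]. *)
Lemma count_usable (R : realType) (z h x : nat) : (20 <= h)%N ->
  16 * prime_recip R z predT <= h%:R ->
  (h <= 5 * count (usable R z x) (iota 1 h))%N.
Proof.
move=> h20 /(count_prime_recip_dist_gt x).
set heavy := fun a : nat => 3 / 4 < _; set C := count heavy _.
rewrite mulrAC ler_pdivlMr // -!natrM ler_nat => C_le.
have eq_le : (count (pred1 x) (iota 1 h) <= 1)%N.
  by rewrite count_uniq_mem ?iota_uniq // leq_b1.
have not_usable : (count (predC (usable R z x)) (iota 1 h) <=
    count (pred1 x) (iota 1 h) + C)%N.
  rewrite /C -count_predUI; apply: leq_trans (leq_addr _ _).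
  apply: sub_count => a /=; rewrite /usable negb_and negbK -ltNge => /orP[->//|].
  by rewrite /heavy => ->; rewrite orbT.
have := count_predC (usable R z x) (iota 1 h); rewrite size_iota.
lia.
Qed.

(** In the application [E] contains the numbers up to [n] with many prime
factors, so that for an exceptional [x] the sieve fails on every column. *)
Definition exceptional (R : realType) (z h : nat) (E : {fset nat}) (x : nat) :=
  all (fun a => usable R z x a ==> (`|a%:Z - x%:Z|%N \in E)) (iota 1 h).

Lemma count_dist_mem (E : {fset nat}) (n a : nat) :
  (count (fun x => `|a%:Z - x%:Z|%N \in E) (iota 1 n) <= 2 * #|` E|)%N.
Proof.
rewrite -size_filter mul2n -addnn -{1}(size_map (addn a) E).
rewrite -(size_map (subn a) E) -size_cat; apply: uniq_leq_size.
  by rewrite filter_uniq ?iota_uniq.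
move=> x; rewrite mem_filter mem_cat => /andP[xE _]; apply/orP.
have [ax|xa] := leqP a x.
  by left; apply/mapP; exists `|a%:Z - x%:Z|%N => //; lia.
by right; apply/mapP; exists `|a%:Z - x%:Z|%N => //; lia.
Qed.

(** Double count the pairs [(x, a)] with [|a - x|] in [E]: an exceptional [x]
belongs to at least [h / 5] of them, and each of the [h] values of [a] to at
most [2 |E|]. *)
Lemma count_exceptional (R : realType) (z h n : nat) (E : {fset nat}) :
  (20 <= h)%N -> 16 * prime_recip R z predT <= h%:R ->
  (count (exceptional R z h E) (iota 1 n) <= 10 * #|` E|)%N.
Proof.
move=> h20 hM; have h0 : (0 < h)%N by lia.
rewrite -(leq_pmul2r h0).
pose T := (\sum_(x <- iota 1 n) count (fun a => `|a%:Z - x%:Z|%N \in E) (iota 1 h))%N.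
have T_le : (T <= h * (2 * #|` E|))%N.
  rewrite /T; under eq_bigr do rewrite -sum1_count big_mkcond /=.
  rewrite exchange_big /=.
  apply: (@leq_trans (\sum_(a <- iota 1 h) 2 * #|` E|)%N).
    by apply: leq_sum => a _; rewrite -big_mkcond /= sum1_count count_dist_mem.
  by rewrite big_const_seq count_predT iter_addn_0 size_iota mulnC.
have le_T : (count (exceptional R z h E) (iota 1 n) * h <= 5 * T)%N.
  rewrite -sum1_count big_distrl /T big_distrr /= big_mkcond /=.
  apply: leq_sum => x _; case: ifP => // /allP exc_x; rewrite mul1n.
  apply: leq_trans (count_usable x h20 hM) _; rewrite leq_mul2l /=.
  rewrite -!size_filter; apply: uniq_leq_size; first by rewrite filter_uniq ?iota_uniq.
  by move=> a; rewrite !mem_filter => /andP[ua ah]; rewrite ah (implyP (exc_x a ah)).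
lia.
Qed.

Lemma not_exceptional_coprime (R : realType) (K z h n : nat) (E : {fset nat})
    (x y : nat) :
  (0 < K)%N -> (16 * K <= z)%N -> (h <= n)%N ->
  (forall m, (0 < m <= n)%N -> m \notin E -> (omega m <= K)%N) ->
  (0 < x <= n)%N -> ~~ exceptional R z h E x ->
  exists a b, [/\ a \in iota 1 h, b \in iota 1 (6 * K)
    & coprime `|a%:Z - x%:Z| `|b%:Z - y%:Z|].
Proof.
move=> K0 Kz hn omegaK xn /allPn[a ah]; rewrite negb_imply => /andP[].
move=> /andP[ax small] aE; have := ah; rewrite mem_iota => ah'.
have d_bounds : (0 < `|a%:Z - x%:Z| <= n)%N by move/eqP: ax; lia.
have [b bK cop] := exists_coprime_dist_of_small_recip y K0 Kz
  (proj1 (andP d_bounds)) (omegaK _ d_bounds aE) small.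
by exists a, b.
Qed.

(** * The viewing set *)

Definition box (s t : seq nat) : {fset lattice_point} :=
  [fset P in [seq (x%:Z, y%:Z) | x <- s, y <- t]]%fset.

Lemma card_box (s t : seq nat) : (#|` box s t| <= size s * size t)%N.
Proof. by rewrite card_fseq (leq_trans (size_undup _)) // size_allpairs. Qed.

Lemma boxP (s t : seq nat) (P : lattice_point) :
  reflect (exists x y, [/\ x \in s, y \in t & P = (x%:Z, y%:Z)]) (P \in box s t).
Proof.
rewrite inE /=; apply: (iffP allpairsP) => [[[x y] [xs yt ->]]|[x [y [xs yt ->]]]].
  by exists x, y.
by exists (x, y).
Qed.

Lemma box_sub_grid (k l n : nat) : (k <= n)%N -> (l <= n)%N ->
  (box (iota 1 k) (iota 1 l) `<=` grid n)%fset.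
Proof.
move=> kn ln; apply/fsubsetP => _ /boxP[x [y [+ + ->]]].
by rewrite !mem_iota in_grid /=; lia.
Qed.

Definition viewers (h J : nat) : {fset lattice_point} :=
  (box (iota 1 h) (iota 1 J) `|` box (iota 1 J) (iota 1 h))%fset.

Lemma card_viewers (h J : nat) : (#|` viewers h J| <= 2 * (h * J))%N.
Proof.
rewrite cardfsU (leq_trans (leq_subr _ _)) // mul2n -addnn.
apply: leq_add; apply: leq_trans (card_box _ _) _; rewrite !size_iota //.
by rewrite mulnC.
Qed.

Lemma in_invisible (R : realType) (n : nat) (B : {fset lattice_point})
    (P : lattice_point) :
  (P \in invisible R n B) = (P \in grid n) && ~~ `[< visible_from R B P >].
Proof. by rewrite !inE. Qed.

(** A point missed by the rectangle has an exceptional abscissa, and a point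
missed by the transposed rectangle an exceptional ordinate. *)
Lemma card_invisible_viewers (R : realType) (K z h n : nat) (E : {fset nat}) :
  (0 < K)%N -> (16 * K <= z)%N -> (20 <= h)%N -> (h <= n)%N ->
  16 * prime_recip R z predT <= h%:R ->
  (forall m, (0 < m <= n)%N -> m \notin E -> (omega m <= K)%N) ->
  (#|` invisible R n (viewers h (6 * K))| <= 100 * #|` E| ^ 2)%N.
Proof.
move=> K0 Kz h20 hn hM omegaK.
set X := [seq x <- iota 1 n | exceptional R z h E x].
have sX : (size X <= 10 * #|` E|)%N by rewrite size_filter count_exceptional.
suff sub : (invisible R n (viewers h (6 * K)) `<=` box X X)%fset.
  apply: leq_trans (fsubset_leq_card sub) (leq_trans (card_box _ _) _).
  by apply: leq_trans (leq_mul sX sX) _; lia.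
apply/fsubsetP => P; rewrite in_invisible => /andP[].
case/imfset2P => x /= xn [y /= yn ->]; move/asboolPn => unseen.
apply/boxP; exists x, y; split=> //.
  rewrite mem_filter xn andbT; apply: contra_notT unseen => ex.
  have [|a [b [ah bK cop]]] := not_exceptional_coprime y K0 Kz hn omegaK _ ex.
    by move: xn; rewrite mem_iota; lia.
  exists (a%:Z, b%:Z); first by apply/fsetUP; left; apply/boxP; exists a, b.
  by apply/visibleP; rewrite /= coprimezE.
rewrite mem_filter yn andbT; apply: contra_notT unseen => ex.
have [|b [a [bh aK cop]]] := not_exceptional_coprime x K0 Kz hn omegaK _ ex.
  by move: yn; rewrite mem_iota; lia.
exists (a%:Z, b%:Z); first by apply/fsetUP; right; apply/boxP; exists a, b.
by apply/visibleP; rewrite /= coprimezE coprime_sym.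
Qed.

(** * Choice of the parameters *)

Lemma expn2_omega_le (m : nat) : (0 < m)%N -> (2 ^ omega m <= m)%N.
Proof.
move=> m0; apply: (@leq_trans (\prod_(p <- primes m) p)).
  rewrite /omega -(count_predT (primes m)) -iter_muln_1 -big_const_seq.
  rewrite big_seq [leqRHS]big_seq; apply: leq_prod => p.
  by rewrite mem_primes => /andP[/prime_gt1].
apply: dvdn_leq => //; apply: prod_primes_dvdn (primes_uniq m) _ => p.
by rewrite mem_primes => /and3P[].
Qed.

Lemma omega_le_trunc_log (m n : nat) : (0 < m <= n)%N -> (omega m <= trunc_log 2 n)%N.
Proof.
by move=> /andP[m0 mn]; apply/trunc_log_max/(leq_trans (expn2_omega_le m0) mn).
Qed.

Lemma leq_66mul_expn2 (K : nat) : (10 <= K)%N -> (66 * K <= 2 ^ K)%N.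
Proof.
move=> K10; rewrite -(subnK K10) addnC; elim: (K - 10)%N => [|k IH]; first by [].
by rewrite addnS expnS; lia.
Qed.

(** The factor [2] is an upper bound of [1 / ln 2]. *)
Lemma trunc_log2_le_ln (R : realType) (K : nat) : (0 < K)%N ->
  (trunc_log 2 K)%:R <= 2 * ln K%:R :> R.
Proof.
move=> K0; have ln2 : 2^-1 <= ln 2 :> R.
  have : ln (1 + - 2^-1) <= - 2^-1 :> R by apply: le_ln1Dx; lra.
  have -> : 1 + - 2^-1 = 2^-1 :> R by lra.
  by rewrite lnV ?posrE // lerN2.
have : ln (2 ^+ trunc_log 2 K) <= ln K%:R :> R.
  by rewrite ler_ln ?posrE ?exprn_gt0 ?ltr0n // -natrX ler_nat trunc_logP.
rewrite lnXn // -[_ *+ trunc_log 2 K]mulr_natr => tK.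
have : 2^-1 * (trunc_log 2 K)%:R <= ln 2 * (trunc_log 2 K)%:R :> R.
  by rewrite ler_wpM2r.
lra.
Qed.

(** With [z = 2 ^ (t + 5)] and [2 ^ t <= K < 2 ^ (t + 1)], the sum [M] of the
prime reciprocals up to [z] is at most [5 / 2 + 2 ln (t + 4)], and
[t + 4 <= 4 ln K], so that [16 M + 20 <= 156 + 32 ln (ln K)]; this is at most
[66 ln (ln K)] once [ln (ln K) >= 6]. *)
Lemma exists_sieve_level_and_height (R : realType) (K : nat) : (0 < K)%N ->
  6 <= ln (ln K%:R) :> R ->
  exists z h, [/\ (16 * K <= z)%N, (20 <= h)%N,
    16 * prime_recip R z predT <= h%:R & h%:R <= 66 * ln (ln K%:R) :> R].
Proof.
move=> K0 X6; set t := trunc_log 2 K.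
exists (2 ^ t.+3.+2)%N, (Num.truncn (16 * prime_recip R (2 ^ t.+3.+2) predT) + 20)%N.
have M0 : 0 <= 16 * prime_recip R (2 ^ t.+3.+2) predT.
  by rewrite mulr_ge0 // prime_recip_ge0.
have /andP[trM Mtr] := truncn_itv M0.
have lnK0 : 0 < ln K%:R :> R.
  by rewrite ltNge; apply/negP => /ln0 lnln0; move: X6; rewrite lnln0; lra.
have lnK6 : 6 <= ln K%:R :> R.
  by apply: le_trans X6 _; apply/ltW/ln_sublinear.
have tK := trunc_log2_le_ln R K0.
have M_le := prime_recip_pow2_ln R t.+3.
have ln_t : ln t.+4%:R <= 3 + ln (ln K%:R) :> R.
  apply: (@le_trans _ _ (ln (4 * ln K%:R))).
    rewrite ler_ln ?posrE ?ltr0n ?mulr_gt0 //.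
    by rewrite -addn4 natrD; rewrite -/t in tK; lra.
  rewrite lnM ?posrE // lerD2r.
  have : ln (1 + 3) <= 3 :> R by apply: le_ln1Dx; lra.
  by rewrite (_ : 1 + 3 = 4 :> R) //; lra.
split.
- have := @trunc_log_ltn 2 K isT; rewrite -/t => Kt.
  by rewrite -[t.+3.+2]/(4 + t.+1)%N expnD; apply: leq_mul => //; exact: ltnW.
- by rewrite leq_addl.
- by rewrite natrD; move: Mtr; rewrite -natr1; lra.
- by rewrite natrD; lra.
Qed.

Theorem theorem5 (R : realType) (g : nat -> R)
    (g_infty : g n @[n --> \oo] --> +oo) :
  \forall n \near \oo, exists B : {fset lattice_point},
    [/\ (B `<=` grid n)%fset,
        (#|` invisible R n B| <= 100 * #|` E_set g n| ^ 2)%N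
      & (#|` B|)%:R <= 800 * g n * ln (ln (g n))].
Proof.
pose C := (Num.truncn (expR (expR 6) : R) + 10)%N.
have g_ge : \forall n \near \oo, C%:R <= g n by move/cvgryPge: g_infty.
near=> n.
have gC : C%:R <= g n by near: n.
have nC : (2 ^ C <= n)%N by near: n; exact: nbhs_infty_ge.
(* Both terms bound the number of prime factors of any [m <= n] outside
   [E_set g n]; the second one keeps [B] inside the grid. *)
set K := minn (Num.truncn (g n)) (trunc_log 2 n).
have g0 : 0 <= g n by apply: le_trans gC.
have n0 : (0 < n)%N by apply: leq_trans nC; rewrite expn_gt0.
have CK : (C <= K)%N by rewrite leq_min truncn_ge_nat // gC trunc_log_max.
have K10 : (10 <= K)%N by apply: leq_trans CK; rewrite leq_addl.
have K0 : (0 < K)%N by apply: leq_trans K10.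
have expK : expR (expR 6) <= K%:R :> R.
  apply/ltW/(lt_le_trans (truncnS_gt _)); rewrite ler_nat.
  by apply: leq_trans CK; rewrite /C addnS ltnS leq_addr.
have Kg : K%:R <= g n.
  by apply: (@le_trans _ _ (Num.truncn (g n))%:R); rewrite ?truncn_le // ler_nat geq_minl.
have lnK : expR 6 <= ln K%:R :> R.
  by rewrite -[leLHS]expRK ler_ln // posrE ?expR_gt0 ?ltr0n.
have lnlnK : 6 <= ln (ln K%:R) :> R.
  rewrite -[leLHS]expRK ler_ln // posrE ?expR_gt0 //.
  exact: lt_le_trans (expR_gt0 _) lnK.
have [z [h [Kz h20 Mh hK]]] := exists_sieve_level_and_height K0 lnlnK.
have Kn : (66 * K <= n)%N.
  apply: leq_trans (leq_66mul_expn2 K10) _.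
  apply: leq_trans (trunc_logP (isT : 1 < 2)%N n0).
  by rewrite leq_exp2l // geq_minr.
have lnK0 : 0 < ln K%:R :> R by apply: lt_le_trans lnK; exact: expR_gt0.
have lnlnK_le : ln (ln K%:R) <= K%:R :> R.
  apply/ltW/(lt_trans (ln_sublinear lnK0))/ln_sublinear; by rewrite ltr0n.
have hn : (h <= n)%N.
  apply: leq_trans Kn; rewrite -(ler_nat R) natrM; lra.
(* The cardinality is at most [2 * h * 6 K <= 12 * 66 * K ln (ln K)], and
   [12 * 66 = 792]. *)
exists (viewers h (6 * K)); split.
- by rewrite fsubUset !box_sub_grid //; lia.
- apply: card_invisible_viewers Kz h20 hn Mh _ => // m mn mE.
  rewrite leq_min omega_le_trunc_log // andbT truncn_ge_nat //.
  apply/ltW; rewrite ltNge; apply: contra mE => gm.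
  by rewrite !inE /= mem_iota add1n ltnS mn.
- apply: (@le_trans _ _ (2 * (h * (6 * K)))%N%:R); first by rewrite ler_nat card_viewers.
  have lnln_le : ln (ln K%:R) <= ln (ln (g n)).
    have Kr0 : 0 < K%:R :> R by rewrite ltr0n.
    have lnKg : ln K%:R <= ln (g n).
      by rewrite ler_ln ?posrE // (lt_le_trans Kr0).
    by rewrite ler_ln ?posrE // (lt_le_trans lnK0).
  apply: (@le_trans _ _ (800 * (K%:R * ln (ln K%:R)))); last first.
    rewrite -mulrA ler_wpM2l // ler_pM //; lra.
  rewrite !natrM.
  have : h%:R * K%:R <= 66 * ln (ln K%:R) * K%:R :> R by rewrite ler_wpM2r.
  have : 0 <= ln (ln K%:R) * K%:R :> R by rewrite mulr_ge0 //; lra.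
  lra.
Unshelve. all: by end_near. Qed.
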